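(* A hereditary family of graphs has the Erdős–Hajnal property if and only if it has the polynomial close Rödl property.
   Context: A family of finite graphs is hereditary if closed under induced subgraphs. $\hom(G)$ is the size of a largest clique or independent set in $G$. $\mathcal{F}$ has the Erdős–Hajnal property if there is $c>0$ such that every $G\in\mathcal{F}$ on $n$ vertices has $\hom(G)\ge n^c$. A vertex set $S$ is $\varepsilon$-homogeneous if the edge density of $G[S]$ is at most $\varepsilon$ or at least $1-\varepsilon$. A graph $G$ on $n$ vertices is $\alpha$-close to $\mathcal{F}$ if one can add or delete at most $\alpha n^2/2$ edges of $G$ to obtain a graph in $\mathcal{F}$. $\mathcal{F}$ has the polynomial close Rödl property if there are $C,d>0$ such that for every $0<\varepsilon<1/2$, every graph on $n$ vertices that is $\varepsilon^{d}$-close to $\mathcal{F}$ contains an $\varepsilon$-homogeneous set of size at least $\varepsilon^{C}n$. *)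

(* Defs.v *)
From HB Require Import structures.
From mathcomp Require Import all_boot all_order all_algebra.
From mathcomp Require Import reals exp.

Set Implicit Arguments.
Unset Strict Implicit.
Unset Printing Implicit Defensive.

Import Order.TTheory GRing.Theory Num.Theory.

Local Open Scope ring_scope.

Record graph (V : finType) := Graph {
  adj : rel V;
  adj_sym : symmetric adj;
  adj_irrefl : irreflexive adj
}.

Definition edges (V : finType) (G : graph V) : {set {set V}} :=
  [set e : {set V} | [exists x, exists y, adj G x y && (e == [set x; y])]].

Section Induced.
Variables (V : finType) (G : graph V) (S : {set V}).

Definition induced_adj : rel {x : V | x \in S} :=
  fun x y => adj G (val x) (val y).

Lemma induced_adj_sym : symmetric induced_adj.
Proof. by move=> x y; apply: adj_sym. Qed.

Lemma induced_adj_irrefl : irreflexive induced_adj.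
Proof. by move=> x; apply: adj_irrefl. Qed.

Definition induced : graph {x : V | x \in S} :=
  Graph induced_adj_sym induced_adj_irrefl.

End Induced.

Definition isomorphic (V W : finType) (G : graph V) (H : graph W) : Prop :=
  exists2 f : V -> W, bijective f & forall x y, adj H (f x) (f y) = adj G x y.

(* Vertex sets range over all finite types, so membership in a family is
   required not to depend on the names of the vertices. *)
Record graph_family := GraphFamily {
  in_family :> forall V : finType, graph V -> Prop;
  in_family_iso : forall (V W : finType) (G : graph V) (H : graph W),
    isomorphic G H -> in_family G -> in_family H
}.

Definition hereditary (F : graph_family) : Prop :=
  forall (V : finType) (G : graph V) (S : {set V}), F V G -> F _ (induced G S).

Definition is_clique (V : finType) (G : graph V) (S : {set V}) : bool :=
  [forall x in S, forall y in S, (x != y) ==> adj G x y].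

Definition is_independent (V : finType) (G : graph V) (S : {set V}) : bool :=
  [forall x in S, forall y in S, ~~ adj G x y].

Definition hom (V : finType) (G : graph V) : nat :=
  \max_(S : {set V} | is_clique G S || is_independent G S) #|S|.

Definition erdos_hajnal (R : realType) (F : graph_family) : Prop :=
  exists2 c : R, 0 < c &
    forall (V : finType) (G : graph V), F V G ->
      (#|V|%:R : R) `^ c <= (hom G)%:R.

(* On at most one vertex the quotient is 0 / 0 = 0, so that sets with at most
   one element are homogeneous. *)
Definition edge_density (R : realType) (V : finType) (G : graph V) : R :=
  #|edges G|%:R / 'C(#|V|, 2)%:R.

Definition homogeneous (R : realType) (V : finType) (G : graph V)
    (eps : R) (S : {set V}) : Prop :=
  edge_density R (induced G S) <= eps \/
  1 - eps <= edge_density R (induced G S).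

Definition close_to (R : realType) (F : graph_family) (alpha : R)
    (V : finType) (G : graph V) : Prop :=
  exists2 H : graph V, F V H &
    #|(edges G :\: edges H) :|: (edges H :\: edges G)|%:R
      <= alpha * #|V|%:R ^+ 2 / 2.

Definition polynomial_close_rodl (R : realType) (F : graph_family) : Prop :=
  exists C d : R, [/\ 0 < C, 0 < d &
    forall eps : R, 0 < eps -> eps < 1 / 2 ->
    forall (V : finType) (G : graph V), close_to F (eps `^ d) G ->
      exists2 S : {set V}, homogeneous G eps S &
        eps `^ C * #|V|%:R <= #|S|%:R].

(* Main.v *)
Require Import Defs.
From HB Require Import structures.
From mathcomp Require Import all_boot all_order all_algebra.
From mathcomp Require Import reals exp.
From mathcomp Require Import sequences ring lra zify.

Set Implicit Arguments.
Unset Strict Implicit.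
Unset Printing Implicit Defensive.

Import Order.TTheory GRing.Theory Num.Theory.

Local Open Scope ring_scope.

(** From the close Rödl property: an [eps]-homogeneous set [S] of a graph [G]
    in [F], with [eps] a small negative power of [n] and [#|S| >= 1 / eps],
    contains a homogeneous set of size about [1 / (2 eps)] by Turán's theorem.

    From the Erdős-Hajnal property: suppose that [G] is [eps ^ d]-close to
    [H] in [F] but has no [eps]-homogeneous set of size [delta n], and let [m]
    be a large power of [1 / eps] and [delta = m ^ -4].  A uniformly random
    [m]-set of vertices avoids with probability at least 1/2 all pairs on
    which [G] and [H] differ.  Every set of more than [delta n] vertices has a
    vertex of large degree both in [G] and in its complement, so the
    Kleitman-Winston argument bounds the number of cliques and of independent
    sets of size [h], where [h] is about [log (1 / eps) / eps]; a random
    [m]-set is unlikely to contain any of them.  Some [m]-set thus induces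
    a graph of [F] without homogeneous set of size [h <= m ^ c]. *)

(** * Complement graphs *)

Section Complement.
Variables (V : finType) (G : graph V).

Definition compl_adj : rel V := fun x y => (x != y) && ~~ adj G x y.

Lemma compl_adj_sym : symmetric compl_adj.
Proof. by move=> x y; rewrite /compl_adj eq_sym adj_sym. Qed.

Lemma compl_adj_irrefl : irreflexive compl_adj.
Proof. by move=> x; rewrite /compl_adj eqxx. Qed.

Definition compl : graph V := Graph compl_adj_sym compl_adj_irrefl.

Lemma is_clique_compl (S : {set V}) : is_clique G S = is_independent compl S.
Proof.
apply: eq_forallb => x; congr (_ ==> _); apply: eq_forallb => y.
by rewrite /= /compl_adj negb_and !negbK implyNb.
Qed.

End Complement.

(** * Degree sums inside a vertex set *)

Section Degrees.
Variables (V : finType) (G : graph V).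

Definition nbrs (S : {set V}) (x : V) : {set V} := [set y in S | adj G x y].

Definition degsum (S : {set V}) : nat := \sum_(x in S) #|nbrs S x|.

Lemma edgesE (x y : V) : ([set x; y] \in edges G) = adj G x y.
Proof.
rewrite inE; apply/existsP/idP => [[a /existsP[b /andP[ab /eqP E]]]|xy].
  have ne : a != b by apply: contraTneq ab => ->; rewrite adj_irrefl.
  have := set22 a b; have := set21 a b; rewrite -E !inE.
  by move=> /orP[]/eqP ha /orP[]/eqP hb; move: ne ab; subst;
     rewrite ?eqxx // adj_sym.
by exists x; apply/existsP; exists y; rewrite xy eqxx.
Qed.

(** Handshake lemma: ordered adjacent pairs are grouped by the edge they span, and each edge
    receives exactly its two orientations. *)
Lemma card_edges : (\sum_x #|[set y | adj G x y]|)%N = (2 * #|edges G|)%N.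
Proof.
have -> : (\sum_x #|[set y | adj G x y]|)%N = (\sum_(p : V * V | adj G p.1 p.2) 1)%N.
  rewrite -(pair_big_dep xpredT (fun x y => adj G x y) (fun _ _ => 1%N)) /=.
  by apply: eq_bigr => x _; rewrite sum1dep_card.
rewrite (partition_big (fun p => [set p.1; p.2]) (mem (edges G))) /=; last first.
  by case=> x y /=; rewrite edgesE.
rewrite mulnC -sum_nat_const; apply: eq_bigr => e.
rewrite inE => /existsP[a /existsP[b /andP[ab /eqP ->]]].
have ne : a != b by apply: contraTneq ab => ->; rewrite adj_irrefl.
rewrite sum1dep_card.
have -> : [set p : V * V | adj G p.1 p.2 && ([set p.1; p.2] == [set a; b])]
    = [set (a, b); (b, a)].
  apply/setP => -[x y]; rewrite !inE /= !xpair_eqE.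
  apply/andP/orP => [[xy /eqP E]|[] /andP[/eqP-> /eqP->]]; last 2 first.
  - by rewrite ab.
  - by rewrite adj_sym ab setUC.
  have nxy : x != y by apply: contraTneq xy => ->; rewrite adj_irrefl.
  have := set21 x y; have := set22 x y; rewrite E !inE.
  move=> /orP[]/eqP ha /orP[]/eqP hb; move: nxy; subst; rewrite ?eqxx //;
  by [right|left].
by rewrite cards2 xpair_eqE (negPf ne).
Qed.

Lemma is_independent_subset (A B : {set V}) :
  A \subset B -> is_independent G B -> is_independent G A.
Proof.
move=> /subsetP AB /forall_inP iB; apply/forall_inP => x /AB xB.
by apply/forall_inP => y /AB yB; move/forall_inP: (iB x xB); apply.
Qed.

Lemma is_independentU1 (v : V) (I : {set V}) :
  is_independent G (v |: I) = is_independent G I && (I \subset [set y | ~~ adj G v y]).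
Proof.
apply/idP/andP => [iI|[/forall_inP iI /subsetP nI]].
  split; first by apply: is_independent_subset iI; apply: subsetUr.
  apply/subsetP => y yI; rewrite inE; move/forall_inP: iI => /(_ v (setU11 _ _)).
  by move/forall_inP; apply; rewrite setU1r.
apply/forall_inP => x /setU1P[->|xI]; apply/forall_inP => y /setU1P[->|yI].
- by rewrite adj_irrefl.
- by have := nI y yI; rewrite inE.
- by have := nI x xI; rewrite inE adj_sym.
- by move/forall_inP: (iI x xI); apply.
Qed.

End Degrees.

Lemma card_edges_induced (V : finType) (G : graph V) (S : {set V}) :
  (2 * #|edges (induced G S)|)%N = degsum G S.
Proof.
rewrite /degsum (big_sub (mem S) (fun x => #|nbrs G S x|)) -card_edges.
apply: eq_bigr => x _; rewrite -(card_imset _ val_inj).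
congr #|pred_of_set _|; apply/setP => y; apply/imsetP/idP => [[z + ->]|].
  by rewrite !inE => xz; rewrite (valP z).
by rewrite inE => /andP[yS xy]; exists (exist _ y yS); rewrite ?inE.
Qed.

Lemma degsum_compl (V : finType) (G : graph V) (S : {set V}) :
  (degsum G S + degsum (compl G) S)%N = (#|S| * #|S|.-1)%N.
Proof.
rewrite -big_split -sum_nat_const; apply: eq_bigr => x xS /=.
rewrite (cardsD1 x S) xS add1n /= -(cardsID (nbrs G S x) (S :\ x)).
congr (_ + _)%N; apply: eq_card => y; rewrite !inE /= /compl_adj eq_sym.
  by case: eqVneq => [->|]; rewrite ?adj_irrefl ?andbF //= andbA andbb.
by rewrite negb_and; case: (y \in S); rewrite ?andbF //= andbT andbC.
Qed.

(** * Homogeneity in terms of degree sums *)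

Section Homogeneous.
Variables (R : realType) (V : finType) (G : graph V).

Lemma edge_densityE (S : {set V}) :
  edge_density R (induced G S) = (degsum G S)%:R / (#|S| * #|S|.-1)%:R.
Proof.
rewrite /edge_density -card_edges_induced.
have -> : #|{: {x : V | x \in S}}| = #|S| by rewrite card_sub.
have -> : (#|S| * #|S|.-1)%N = (2 * 'C(#|S|, 2))%N.
  by rewrite mul2n bin2 halfK oddM; case: #|S| => // n; rewrite /= andNb subn0.
by rewrite !natrM -mulf_div divff ?mul1r // pnatr_eq0.
Qed.

(** By [degsum_compl], density at least [1 - eps] in [G] is density at most [eps] in the complement,
    so later arguments treat only the sparse case. *)
Lemma homogeneousE (eps : R) (S : {set V}) : 0 <= eps ->
  homogeneous G eps S <->
  exists2 H, H = G \/ H = compl G &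
    (degsum H S)%:R <= eps * (#|S| * #|S|.-1)%:R.
Proof.
move=> eps0; rewrite /homogeneous edge_densityE.
have := degsum_compl G S; set a := (#|S| * _)%N => Ea.
(* With at most one vertex the density is [0 / 0 = 0], and both sides hold. *)
have [a0|a_gt0] := posnP a.
  rewrite a0 mulr0n invr0 mulr0; split=> _; last by left.
  exists G; first by left.
  by rewrite mulr0; move: Ea; rewrite a0; case: degsum.
have a_gt0' : 0 < a%:R :> R by rewrite ltr0n.
have E : (degsum (compl G) S)%:R = a%:R - (degsum G S)%:R :> R.
  by rewrite -Ea natrD addrC addKr.
split=> [[]|[H [] ->]].
- by rewrite ler_pdivrMr // => ?; exists G; [left|].
- rewrite ler_pdivlMr // => ?; exists (compl G); first by right.
  by rewrite E; lra.
- by left; rewrite ler_pdivrMr.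
- by rewrite E => ?; right; rewrite ler_pdivlMr //; lra.
Qed.

End Homogeneous.

(** * Caro-Wei and Turán bounds *)

Section CaroWei.
Variables (R : realFieldType) (V : finType) (G : graph V).

Lemma nbrs_sub (A B : {set V}) x : A \subset B -> nbrs G A x \subset nbrs G B x.
Proof. by move=> /subsetP AB; apply/subsetP => y; rewrite !inE => /andP[/AB-> ->]. Qed.

(** Greedy choice: select [v] of least degree and delete its closed neighbourhood [N]. The terms of
    [N] sum to at most 1, and deletion only lowers the other degrees, which increases their
    terms. *)
Lemma caro_wei (S : {set V}) :
  exists2 I : {set V}, (I \subset S) && is_independent G I &
    \sum_(v in S) (#|nbrs G S v|.+1%:R)^-1 <= #|I|%:R :> R.
Proof.
have [n leSn] := ubnP #|S|; elim: n S leSn => // n IHn S leSn.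
have [->|[v0 v0S]] := set_0Vmem S.
  exists set0; last by rewrite big_set0.
  by rewrite sub0set /=; apply/forall_inP => x; rewrite inE.
have [v /= vS' vmin] := arg_minnP (fun x => #|nbrs G S x|) v0S.
have vS : v \in S by exact: vS'.
set N := v |: nbrs G S v.
have NS : N \subset S.
  by rewrite subUset sub1set vS; apply/subsetP => y; rewrite inE => /andP[].
have cN : #|N| = #|nbrs G S v|.+1.
  by rewrite cardsU1 inE adj_irrefl andbF.
have [|I /andP[IS iI] Isum] := IHn (S :\: N).
  have := cardsID N S; rewrite (setIidPr NS) cN; lia.
have vI : v \notin I by apply/negP => /(subsetP IS); rewrite !inE eqxx.
exists (v |: I).
  rewrite is_independentU1 iI subUset sub1set vS (subset_trans IS (subsetDl _ _)) /=.
  apply/subsetP => y /(subsetP IS); rewrite !inE negb_or negb_and.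
  by case/andP => /andP[_] + yS; rewrite yS.
rewrite cardsU1 vI natrD (big_setID N) /= (setIidPr NS); apply: lerD.
  apply: (@le_trans _ _ (\sum_(i in N) (#|N|%:R)^-1)).
    apply: ler_sum => i iN; rewrite cN lef_pV2 ?posrE ?ltr0n // ler_nat ltnS.
    by apply: vmin; apply: (subsetP NS).
  by rewrite sumr_const -[leLHS]mulr_natr mulVf // pnatr_eq0 cN.
apply: le_trans Isum; apply: ler_sum => i iS.
by rewrite lef_pV2 ?posrE ?ltr0n // ler_nat ltnS subset_leq_card // nbrs_sub // subsetDl.
Qed.

(* Each term of the Caro-Wei sum is bounded below by the tangent of [1 / x] at
   [x = b]. *)
Lemma turan (S : {set V}) (b : R) : 0 < b ->
  (degsum G S)%:R <= (b - 1) * #|S|%:R ->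
  exists2 I : {set V}, (I \subset S) && is_independent G I & #|S|%:R / b <= #|I|%:R.
Proof.
move=> b0 hb; have [I PI le_I] := caro_wei S; exists I => //.
apply: le_trans le_I.
apply: (@le_trans _ _ (\sum_(v in S) (2 / b - #|nbrs G S v|.+1%:R / b ^+ 2))); last first.
  apply: ler_sum => v _; set d := #|_|.+1%:R; have d0 : 0 < d by rewrite ltr0n.
  clearbody d.
  rewrite -subr_ge0.
  have -> : d^-1 - (2 / b - d / b ^+ 2) = (d - b) ^+ 2 / (d * b ^+ 2).
    by field; rewrite (gt_eqF b0) (gt_eqF d0).
  by rewrite divr_ge0 ?sqr_ge0 // mulr_ge0 ?sqr_ge0 // ltW.
rewrite sumrB sumr_const -mulr_suml -natr_sum.
have -> : (\sum_(i in S) #|nbrs G S i|.+1 = degsum G S + #|S|)%N.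
  by rewrite -sum1_card -big_split; apply: eq_bigr => i _; rewrite /= addn1.
rewrite natrD -[(2 / b) *+ _]mulr_natr.
have : ((degsum G S)%:R + #|S|%:R) / b ^+ 2 <= (b * #|S|%:R) / b ^+ 2.
  by rewrite ler_pM2r ?invr_gt0 ?exprn_gt0 //; lra.
have -> : (b * #|S|%:R) / b ^+ 2 = #|S|%:R / b by field; rewrite gt_eqF.
by lra.
Qed.

End CaroWei.

(** * Kleitman-Winston counting through the independence polynomial *)

Section IndependencePolynomial.
Variables (R : realFieldType) (V : finType) (G : graph V) (lam : R).

Definition indep_poly (A : {set V}) : R :=
  \sum_(I : {set V} | (I \subset A) && is_independent G I) lam ^+ #|I|.

Hypothesis lam_ge0 : 0 <= lam.

Lemma ler_sum_subpred (T : finType) (P Q : pred T) (f : T -> R) :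
  (forall i, 0 <= f i) -> (forall i, P i -> Q i) ->
  \sum_(i | P i) f i <= \sum_(i | Q i) f i.
Proof.
move=> f0 PQ; rewrite big_mkcond [leRHS]big_mkcond; apply: ler_sum => i _.
by case: ifP => [/PQ ->//|_]; case: ifP.
Qed.

Lemma indep_poly_le (A : {set V}) : indep_poly A <= (1 + lam) ^+ #|A|.
Proof.
(* Vertices outside [A] contribute a factor [0 + 1], so the product runs over all of [V] and expands
   into a sum over all vertex sets. *)
have -> : (1 + lam) ^+ #|A| = \prod_(i : V) ((if i \in A then lam else 0) + 1).
  rewrite -prodr_const big_mkcond; apply: eq_bigr => i _.
  by case: ifP; rewrite ?add0r // addrC.
rewrite bigA_distr /indep_poly big_mkcond; apply: ler_sum => J _.
case: ifP => [/andP[/subsetP JA _]|_].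
  rewrite -prodr_const big_mkcond le_eqVlt; apply/orP; left; apply/eqP.
  by apply: eq_bigr => i _; case: ifP => // /JA ->.
by apply: prodr_ge0 => i _; do 2?case: ifP.
Qed.

(** An independent set either avoids [v], or is [v] together with an independent set of
    non-neighbours of [v]. *)
Lemma indep_polyD1 (A : {set V}) v : v \in A ->
  indep_poly A <=
    indep_poly (A :\ v) + lam * indep_poly (A :\ v :\: nbrs G A v).
Proof.
move=> vA; rewrite {1}/indep_poly (bigID (fun I : {set V} => v \in I)) /= addrC.
apply: lerD.
  apply: ler_sum_subpred => [I|I]; first exact: exprn_ge0.
  case/andP => /andP[IA ->] vI; rewrite andbT.
  by rewrite subsetD1 IA.
rewrite (reindex_onto (fun I => v |: I) (fun I => I :\ v)) /=; last first.
  by move=> I /andP[_ vI]; rewrite setD1K.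
rewrite mulr_sumr.
apply: (@le_trans _ _ (\sum_(I : {set V} | (I \subset A :\ v :\: nbrs G A v)
                         && is_independent G I) lam ^+ #|v |: I|)); last first.
  apply: ler_sum => I /andP[/subsetP IA _].
  have vI : v \notin I by apply/negP => /IA; rewrite !inE eqxx andbF.
  by rewrite cardsU1 vI exprS.
apply: ler_sum_subpred => [I|I]; first exact: exprn_ge0.
rewrite is_independentU1 => /andP[/andP[/andP[+ /andP[-> /subsetP vI]] _] /eqP DI].
rewrite subUset => /andP[_ /subsetP IA]; rewrite andbT.
apply/subsetP => x xI; rewrite !inE IA //= andbT.
by have := vI x xI; rewrite inE => -> /=; move: xI; rewrite -DI !inE => /andP[].
Qed.

(* Kleitman-Winston: deleting or selecting a vertex of large degree gives the
   recursion [indep_polyD1]; each selection shrinks the set by a factor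
   [theta], so at most [t] selections occur before its size drops to [s]. *)
Lemma indep_poly_bound (theta s E : R) (t : nat) (A : {set V}) :
  0 <= theta ->
  (forall B : {set V}, s < #|B|%:R -> exists2 v, v \in B &
     #|B :\ v :\: nbrs G B v|%:R <= theta * #|B|%:R) ->
  (forall B : {set V}, #|B|%:R <= s -> (1 + lam) ^+ #|B| <= E) ->
  theta ^+ t * #|A|%:R <= s ->
  indep_poly A <= E * (1 + lam * #|A|%:R) ^+ t.
Proof.
move=> theta0 step base.
have [n ltAn] := ubnP #|A|; elim: n A t ltAn => // n IHn A t ltAn leA.
have ge1 (k : nat) : 1 <= 1 + lam * k%:R by rewrite lerDl mulr_ge0.
have [leAs|ltsA] := lerP #|A|%:R s.
  apply: le_trans (indep_poly_le A) _; apply: le_trans (base A leAs) _.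
  rewrite ler_peMr ?exprn_ege1 //; apply: le_trans (base A leAs).
  by rewrite exprn_ge0 // addr_ge0.
(* An exhausted budget [t = 0] would give [#|A| <= s]. *)
case: t leA => [|t leA]; first by rewrite mul1r leNgt ltsA.
have [v vA lev] := step A ltsA.
apply: le_trans (indep_polyD1 vA) _.
have E0 : 0 <= E.
  have s0 : #|set0 : {set V}|%:R <= s.
    rewrite cards0; apply: le_trans leA.
    by rewrite mulr_ge0 // exprn_ge0.
  by apply: le_trans (base _ s0); rewrite exprn_ge0 // addr_ge0.
have cA : #|A| = #|A :\ v|.+1 by rewrite (cardsD1 v A) vA.
have ltB : (#|A :\ v| < n)%N by rewrite -ltnS -cA.
have leB : #|A :\ v|%:R <= #|A|%:R :> R by rewrite cA ler_nat.
have leN : #|A :\ v :\: nbrs G A v|%:R <= #|A|%:R :> R.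
  rewrite ler_nat; apply: leq_trans (subset_leq_card (subsetDl _ _)) _.
  by rewrite cA.
(* Deleting [v] keeps the budget [t.+1]; selecting it costs one unit, paid for by the factor
   [theta]. *)
have h1 := IHn (A :\ v) t.+1 ltB (le_trans (ler_wpM2l (exprn_ge0 _ theta0) leB) leA).
have h2 : indep_poly (A :\ v :\: nbrs G A v) <=
    E * (1 + lam * #|A :\ v :\: nbrs G A v|%:R) ^+ t.
  apply: IHn; first by apply: leq_ltn_trans ltB; apply/subset_leq_card/subsetDl.
  apply: le_trans leA; rewrite exprSr -mulrA.
  by apply: ler_wpM2l; rewrite ?exprn_ge0.
apply: le_trans (lerD h1 (ler_wpM2l lam_ge0 h2)) _.
set a : R := #|A|%:R; set X := 1 + lam * a.
have X0 : 0 <= X by apply: le_trans (ge1 #|A|).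
have ge0 (k : nat) : 0 <= 1 + lam * k%:R by apply: le_trans (ge1 k).
have leX (k : nat) : k%:R <= a -> (1 + lam * k%:R) ^+ t <= X ^+ t.
  by move=> ka; apply: lerXn2r; rewrite ?nnegrE // lerD2l ler_wpM2l.
(* Losing one vertex lowers [X] by exactly [lam], which is what the selecting branch needs. *)
have hX : X = 1 + lam * #|A :\ v|%:R + lam.
  by rewrite /X /a cA -natr1; ring.
apply: (@le_trans _ _ (E * (X ^+ t * (1 + lam * #|A :\ v|%:R)) + lam * (E * X ^+ t))).
  apply: lerD.
    by rewrite exprSr; apply: ler_wpM2l => //; rewrite ler_wpM2r ?leX.
  by do 2!apply: ler_wpM2l => //; apply: leX.
by rewrite le_eqVlt exprSr hX; apply/orP; left; apply/eqP; ring.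
Qed.

Lemma card_indep_le (h : nat) :
  #|[set I : {set V} | is_independent G I & #|I| == h]|%:R * lam ^+ h
    <= indep_poly setT.
Proof.
rewrite -sum1_card natr_sum mulr_suml /indep_poly.
under eq_bigr => I do rewrite mul1r.
apply: (@le_trans _ _ (\sum_(I : {set V} | is_independent G I && (#|I| == h)) lam ^+ #|I|)).
  rewrite le_eqVlt; apply/orP; left; apply/eqP.
  by apply: eq_big => [I|I]; rewrite !inE // => /andP[_ /eqP ->].
apply: ler_sum_subpred => I; first exact: exprn_ge0.
by case/andP => -> _; rewrite subsetT.
Qed.

End IndependencePolynomial.

(** * Random vertex sets of fixed size *)

Section Sampling.
Variables (R : realFieldType) (V : finType).
Let n := #|V|.

(** The ratio of the binomials is a product of factors [(m - i) / (n - i)] for [i < k], each at most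
    [m / n]. *)
Lemma bin_sub_le (m k : nat) : (k <= m <= n)%N ->
  'C(n - k, m - k)%:R * n%:R ^+ k <= 'C(n, m)%:R * m%:R ^+ k :> R.
Proof.
case/andP; elim: k => [|k IHk] km mn; first by rewrite !subn0 !expr0.
have nk : (0 : R) < (n - k)%:R by rewrite ltr0n subn_gt0 (leq_trans km).
rewrite -(ler_pM2l nk).
have E := mul_bin_diag (n - k) (m - k.+1).
have e1 : (n - k).-1 = (n - k.+1)%N by rewrite subnS.
have e2 : (m - k.+1).+1 = (m - k)%N by lia.
rewrite e1 e2 in E.
rewrite mulrA -natrM E natrM.
have := IHk (ltnW km) mn => IH.
have c : (m - k)%:R * n%:R <= (n - k)%:R * m%:R :> R.
  by rewrite -!natrM ler_nat; nia.
have -> : (m - k)%:R * 'C(n - k, m - k)%:R * n%:R ^+ k.+1 =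
  ((m - k)%:R * n%:R) * ('C(n - k, m - k)%:R * n%:R ^+ k) :> R by rewrite exprS; ring.
have -> : (n - k)%:R * ('C(n, m)%:R * m%:R ^+ k.+1) =
  ((n - k)%:R * m%:R) * ('C(n, m)%:R * m%:R ^+ k) :> R by rewrite exprS; ring.
by apply: ler_pM => //; rewrite ?mulr_ge0 // exprn_ge0.
Qed.

(** A random [m]-set contains [I] with probability at most [(m / n) ^ #|I|]: removing [I] injects
    its supersets of size [m] into the [(m - #|I|)]-subsets of the complement. *)
Lemma card_supersets (I : {set V}) (m : nat) : (m <= n)%N ->
  #|[set M : {set V} | I \subset M & #|M| == m]|%:R * n%:R ^+ #|I|
    <= 'C(n, m)%:R * m%:R ^+ #|I| :> R.
Proof.
move=> mn; have [Im|mI] := leqP #|I| m; last first.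
  rewrite (_ : [set _ | _ & _] = set0) ?cards0 ?mul0r ?mulr_ge0 ?exprn_ge0 //.
  apply/setP => M; rewrite !inE; apply/andP => -[/subset_leq_card IM /eqP Mm].
  by move: mI; rewrite -Mm ltnNge IM.
apply: le_trans (bin_sub_le (_ : #|I| <= m <= n)%N); last by rewrite Im.
rewrite ler_wpM2r ?exprn_ge0 // ler_nat.
have -> : (n - #|I| = #|~: I|)%N by rewrite /n -(cardsC I) addKn.
rewrite -cards_draws -(card_in_imset (f := fun M => M :\: I)).
  apply/subset_leq_card/subsetP => _ /imsetP[M + ->].
  rewrite !inE => /andP[IM /eqP <-]; rewrite subDset setUCr subsetT /=.
  by rewrite cardsD (setIidPr IM).
move=> A B; rewrite !inE => /andP[IA _] /andP[IB _] AB.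
by rewrite -(setID A I) -(setID B I) AB (setIidPr IA) (setIidPr IB).
Qed.

Lemma leq_card_bigcup (T I : finType) (P : pred I) (F : I -> {set T}) :
  (#|\bigcup_(i | P i) F i| <= \sum_(i | P i) #|F i|)%N.
Proof.
elim/big_rec2: _ => [|i k A _ le_A]; first by rewrite cards0.
by rewrite (leq_trans (leq_card_setU _ _)) // leq_add2l.
Qed.

(** Union bound over the members of [D], with denominators cleared. *)
Lemma card_hit_le (D : {set {set V}}) (k m : nat) : (m <= n)%N ->
  (forall I, I \in D -> #|I| = k) ->
  #|[set M : {set V} | (#|M| == m) && [exists I in D, I \subset M]]|%:R * n%:R ^+ k
    <= #|D|%:R * ('C(n, m)%:R * m%:R ^+ k) :> R.
Proof.
move=> mn Dk.
apply: (@le_trans _ _ ((\sum_(I in D) #|[set M : {set V} | I \subset M & #|M| == m]|)%:R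
   * n%:R ^+ k)).
  rewrite ler_wpM2r ?exprn_ge0 // ler_nat.
  apply: (@leq_trans #|\bigcup_(I in D) [set M : {set V} | I \subset M & #|M| == m]|).
    apply/subset_leq_card/subsetP => M; rewrite inE => /andP[Mm /existsP[I /andP[ID IM]]].
    by apply/bigcupP; exists I => //; rewrite inE IM.
  by apply: leq_card_bigcup.
rewrite natr_sum mulr_suml -sum1_card natr_sum mulr_suml.
by apply: ler_sum => I ID; rewrite mul1r -(Dk I ID) card_supersets.
Qed.

End Sampling.

(** * Rarity of independent sets of size [h], and choice of a sample *)

Section FewIndependentSets.
Variables (R : realType) (V : finType).
Implicit Types G : graph V.

(** Averaging: if every vertex failed, all degrees would be below [eps * #|S| - 1], hence below
    [eps * (#|S| - 1)] as [eps <= 1]. *)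
Lemma exists_large_degree G (eps : R) (S : {set V}) : eps <= 1 ->
  eps * (#|S| * #|S|.-1)%:R < (degsum G S)%:R ->
  exists2 v, v \in S & #|S :\ v :\: nbrs G S v|%:R <= (1 - eps) * #|S|%:R.
Proof.
move=> eps1; case: (boolP [exists v in S,
    #|S :\ v :\: nbrs G S v|%:R <= (1 - eps) * #|S|%:R]) => [/exists_inP //|].
rewrite negb_exists_in => /forall_inP small; rewrite ltNge => /negP[].
rewrite natr_sum natrM mulrCA mulr_natl -sumr_const.
apply: ler_sum => v vS; have := small v vS; rewrite -ltNge.
have NS : nbrs G S v \subset S :\ v.
  by apply/subsetP => y; rewrite !inE => /andP[-> vy]; rewrite andbT;
     apply: contraTneq vy => ->; rewrite adj_irrefl.
have := cardsD (S :\ v) (nbrs G S v); rewrite (setIidPr NS) => ->.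
have := subset_leq_card NS; have := cardsD1 v S; rewrite vS add1n => -> /= le_d.
by rewrite natrB // -natr1; lra.
Qed.

Lemma expR1_ge2 : 2 <= expR 1 :> R.
Proof. by have := expR_ge1Dx (1 : R). Qed.

(** The bound [1 + x <= expR x] at [x = -1/2] gives [expR (1/2) <= 2]; then square. *)
Lemma expR1_le4 : expR 1 <= 4 :> R.
Proof.
have h : (2 : R)^-1 <= (expR (2^-1))^-1.
  by rewrite -expRN; apply: le_trans (expR_ge1Dx _); lra.
have {}h : expR (2^-1) <= 2 :> R by rewrite -lef_pV2 ?posrE ?expR_gt0.
rewrite [X in expR X](_ : 1 = 2%:R * 2^-1); last by field.
rewrite expRM_natl [leRHS](_ : 4 = 2 ^+ 2); last by ring.
by apply: lerXn2r; rewrite ?nnegrE ?expR_ge0.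
Qed.

(* [t] is such that [(1 - 1 / N) ^ t <= mu ^ -4].  The Kleitman-Winston bound is
   applied with [lam = mu ^ 4 / #|V|], which makes [(1 + lam) ^ #|B|] at most
   [expR 1] on sets [B] of size at most [#|V| / mu ^ 4]. *)
Lemma few_independent_sets G (N q : nat) : (0 < N)%N -> (0 < q)%N -> (0 < #|V|)%N ->
  let mu : R := 2 ^+ q in
  let t := (4 * q * N)%N in
  let h := (2 * t + 2)%N in
  (forall S : {set V}, #|V|%:R / mu ^+ 4 <= #|S|%:R :> R ->
     N%:R^-1 * (#|S| * #|S|.-1)%:R < (degsum G S)%:R :> R) ->
  #|[set I : {set V} | is_independent G I & #|I| == h]|%:R * (mu / #|V|%:R) ^+ h
    <= 16^-1 :> R.
Proof.
move=> N0 q0 V0 mu t h dense; set n : R := #|V|%:R.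
have n0 : 0 < n by rewrite ltr0n.
have NR0 : 0 < N%:R :> R by rewrite ltr0n.
have N1 : N%:R^-1 <= 1 :> R by rewrite invf_le1 // ler1n.
have mu2 : 2 <= mu by rewrite /mu -[leLHS]expr1 ler_weXn2l // ler1n.
have mu0 : 0 < mu by lra.
have mu1 : 1 <= mu by lra.
set lam := mu ^+ 4 / n.
have lam0 : 0 < lam by rewrite divr_gt0 // exprn_gt0.
have lamn : lam * n = mu ^+ 4 by rewrite /lam mulfVK // gt_eqF.
have theta0 : 0 <= 1 - N%:R^-1 :> R by lra.
have thetaN : (1 - N%:R^-1) ^+ N <= 2^-1 :> R.
  apply: (@le_trans _ _ (expR (- N%:R^-1) ^+ N)).
    by apply: lerXn2r; rewrite ?nnegrE ?expR_ge0 // expR_ge1Dx.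
  rewrite -expRM_natl mulrN mulfV ?gt_eqF // expRN.
  by rewrite lef_pV2 ?posrE ?expR_gt0 // expR1_ge2.
have bnd : indep_poly G lam setT <= 4 * (1 + lam * #|[set: V]|%:R) ^+ t.
  apply: (indep_poly_bound (ltW lam0) theta0 (s := n / mu ^+ 4)).
  - by move=> B /ltW/dense; apply: exists_large_degree.
  - move=> B leB; apply: le_trans expR1_le4.
    apply: (@le_trans _ _ (expR lam ^+ #|B|)).
      by apply: lerXn2r; rewrite ?nnegrE ?expR_ge0 ?(addr_ge0 ler01 (ltW lam0)) // expR_ge1Dx.
    rewrite -expRM_natl ler_expR.
    apply: (@le_trans _ _ (n / mu ^+ 4 * lam)); first by rewrite ler_wpM2r // ltW.
    by rewrite /lam mulrA divfK ?divff // gt_eqF // exprn_gt0.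
  - rewrite cardsT -/n mulrC ler_wpM2l ?(ltW n0) //.
    rewrite /t mulnC exprM /mu -(exprM 2) (mulnC q) -exprVn.
    by apply: lerXn2r; rewrite ?nnegrE ?exprn_ge0 // invr_ge0.
have := le_trans (card_indep_le G (ltW lam0) h) bnd.
rewrite cardsT lamn; set cnt := _%:R => {}bnd.
have -> : mu / n = lam / mu ^+ 3.
  by rewrite /lam; field; rewrite (gt_eqF mu0) (gt_eqF n0).
rewrite expr_div_n mulrA ler_pdivrMr ?exprn_gt0 // -exprM.
apply: (le_trans bnd).
have e1 : 1 + mu ^+ 4 <= mu ^+ 5.
  rewrite [mu ^+ 5]exprS; have : 1 <= mu ^+ 4 by rewrite exprn_ege1.
  by nra.
have e2 : (1 + mu ^+ 4) ^+ t <= mu ^+ (5 * t).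
  rewrite exprM; apply: lerXn2r; rewrite ?nnegrE ?addr_ge0 ?exprn_ge0 //; lra.
(* As [h = 2 * t + 2], the divisor [mu ^ (3 * h)] splits into [mu ^ (6 * t)], which absorbs the
   Kleitman-Winston factor, and [mu ^ 6 >= 64], which turns the constant 4 into 1/16. *)
have e3 : mu ^+ (5 * t) <= mu ^+ (6 * t) by rewrite ler_weXn2l // leq_mul2r orbT.
have -> : (3 * h = 6 + 6 * t)%N by rewrite /h; lia.
rewrite exprD.
have e4 : (64 : R) <= mu ^+ 6.
  rewrite [leLHS](_ : 64 = 2 ^+ 6); last by ring.
  by apply: lerXn2r; rewrite ?nnegrE //; lra.
have e5 : 0 < mu ^+ (6 * t) by rewrite exprn_gt0.
nra.
Qed.

(** The three kinds of bad events have probabilities at most 1/2, 1/16 and 1/16, with sum below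
    1. *)
Lemma exists_sample (D C I : {set {set V}}) (m h : nat) :
  (0 < #|V|)%N -> (m <= #|V|)%N ->
  (forall e, e \in D -> #|e| = 2%N) ->
  (forall J, J \in C -> #|J| = h) -> (forall J, J \in I -> #|J| = h) ->
  #|D|%:R * (m%:R / #|V|%:R) ^+ 2 <= 2^-1 :> R ->
  #|C|%:R * (m%:R / #|V|%:R) ^+ h <= 16^-1 :> R ->
  #|I|%:R * (m%:R / #|V|%:R) ^+ h <= 16^-1 :> R ->
  exists2 M : {set V}, #|M| = m &
    forall J : {set V}, J \subset M -> J \notin D /\ J \notin C /\ J \notin I.
Proof.
move=> V0 mV D2 Ch Ih leD leC leI.
pose hit (A : {set {set V}}) :=
  [set M : {set V} | (#|M| == m) && [exists J in A, J \subset M]].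
have bin0 : 0 < 'C(#|V|, m)%:R :> R by rewrite ltr0n bin_gt0.
have hitP (A : {set {set V}}) k : (forall J, J \in A -> #|J| = k) ->
    #|hit A|%:R <= 'C(#|V|, m)%:R * (#|A|%:R * (m%:R / #|V|%:R) ^+ k) :> R.
  move=> Ak; have n0 : 0 < #|V|%:R ^+ k :> R by rewrite exprn_gt0 // ltr0n.
  rewrite -(ler_pM2r n0); apply: le_trans (card_hit_le _ mV Ak) _.
  rewrite le_eqVlt expr_div_n; apply/orP; left; apply/eqP; field.
  by rewrite -natrX gt_eqF // natrX.
have [M Mm Mgood] : exists2 M : {set V}, #|M| == m &
    M \notin hit D :|: (hit C :|: hit I).
  apply/exists_inP; apply: contraT; rewrite negb_exists_in => /forall_inP allhit.
  have : ('C(#|V|, m) <= #|hit D| + (#|hit C| + #|hit I|))%N.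
    rewrite -card_draws; apply: (@leq_trans #|hit D :|: (hit C :|: hit I)|).
      apply/subset_leq_card/subsetP => M; rewrite inE => /allhit.
      by rewrite negbK.
    apply: leq_trans (leq_card_setU _ _) _; rewrite leq_add2l.
    exact: leq_card_setU.
  rewrite -(ler_nat R) !natrD.
  have := hitP D 2 D2; have := hitP C h Ch; have := hitP I h Ih.
  set d := _ * _ ^+ 2 in leD *; set c := _ * _ ^+ h in leC *.
  set i := _ * _ ^+ h in leI *; nra.
exists M => [|J JM]; first exact/eqP.
have nohit (A : {set {set V}}) : M \notin hit A -> J \notin A.
  apply: contra => JA; rewrite inE Mm; apply/exists_inP; by exists J.
by move: Mgood; rewrite !in_setU !negb_or => /and3P[/nohit-> /nohit-> /nohit->].
Qed.

End FewIndependentSets.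

(** * Homogeneous sets in induced subgraphs *)

Section Hom.
Variables (V : finType) (G : graph V).

Lemma leq_hom (S : {set V}) : is_clique G S || is_independent G S -> (#|S| <= Defs.hom G)%N.
Proof. by move=> hS; apply: (leq_bigmax_cond (F := fun S : {set V} => #|S|)). Qed.

Lemma leq_min2_hom : (minn 2 #|V| <= Defs.hom G)%N.
Proof.
have [V1|V1] := leqP #|V| 1.
  rewrite (minn_idPr (leqW V1)); apply: leq_trans (leq_hom (S := setT) _).
    by rewrite cardsT.
  apply/orP; right; apply/forall_inP => x _; apply/forall_inP => y _.
  by rewrite (fintype_le1P V1 x y) adj_irrefl.
rewrite (minn_idPl V1).
have /card_gt1P[x [y [_ _ xy]]] : (1 < #|predT : {pred V}|)%N by [].
rewrite -(_ : #|[set x; y]| = 2%N); last by rewrite cards2 xy.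
apply: leq_hom; have adjC := adj_sym G y x.
have [|] := boolP (adj G x y); rewrite -?adjC => adjyx; apply/orP; [left|right];
  apply/forall_inP => a /set2P[]->; apply/forall_inP => b /set2P[]->;
  by rewrite ?eqxx ?adj_irrefl // -?adjC adjyx ?implybT.
Qed.

(** A maximum homogeneous set is trimmed to size exactly [h], the only size excluded by the
    sampling, and carried back to [V]. *)
Lemma hom_induced (M : {set V}) (h : nat) : (h <= Defs.hom (induced G M))%N ->
  exists2 J : {set V}, (J \subset M) && (#|J| == h) &
    is_clique G J || is_independent G J.
Proof.
have [|S PS maxS] := eq_bigmax_cond (A := [pred S | is_clique (induced G M) S
    || is_independent (induced G M) S]) (fun S => #|S|).
  apply/card_gt0P; exists set0; rewrite inE; apply/orP; right.
  by apply/forall_inP => x; rewrite inE.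
have -> : Defs.hom (induced G M) = #|S| by exact: maxS.
move=> hS; have : (0 < #|[set J : {set {x : V | x \in M}} | J \subset S & #|J| == h]|)%N.
  by rewrite cards_draws bin_gt0.
case/card_gt0P => J; rewrite inE => /andP[/subsetP JS /eqP Jh].
exists [set val x | x in J].
  rewrite card_imset ?Jh ?eqxx ?andbT; last exact: val_inj.
  by apply/subsetP => _ /imsetP[x _ ->]; apply: valP.
case/orP: PS => /forall_inP PS; apply/orP; [left|right];
  apply/forall_inP => _ /imsetP[x xJ ->]; apply/forall_inP => _ /imsetP[y yJ ->].
  by apply/implyP => xy; move/forall_inP: (PS x (JS x xJ)) => /(_ y (JS y yJ))/implyP;
     apply; apply: contraNneq xy => ->.
by move/forall_inP: (PS x (JS x xJ)) => /(_ y (JS y yJ)).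
Qed.

(** The adjacencies agree pointwise, so the identity is an isomorphism; this suffices to pass
    membership in the family from [H] to [G] on [M]. *)
Lemma isomorphic_induced (H : graph V) (M : {set V}) :
  (forall e : {set V}, e \subset M ->
     e \notin (edges G :\: edges H) :|: (edges H :\: edges G)) ->
  isomorphic (induced H M) (induced G M).
Proof.
move=> agree; exists id => [|x y]; first by exists id.
rewrite /= /induced_adj -!edgesE.
have xyM : [set val x; val y] \subset M by rewrite subUset !sub1set (valP x) (valP y).
have := agree _ xyM; rewrite !in_setU !in_setD.
by case: (_ \in edges G); case: (_ \in edges H).
Qed.

End Hom.

(** * Choice of the numerical parameters *)

(** The quadratic term [(K * ln b) ^ 2 / 2] of the exponential series already exceeds [A * K] for
    large [K]. *)
Lemma linear_le_exp (R : realType) (b A : R) : 1 < b ->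
  exists2 K : nat, (0 < K)%N & A * K%:R <= b ^+ K.
Proof.
move=> b1; have lnb : 0 < ln b by rewrite ln_gt0.
pose x := ln b ^+ 2 / 2; have x0 : 0 < x by rewrite divr_gt0 // exprn_gt0.
have [K0 hK0] : exists K0 : nat, A / x <= K0%:R.
  exists (Num.trunc `|A / x|).+1; apply: le_trans (ler_norm _) (ltW _).
  by have /andP[] := truncn_itv (normr_ge0 (A / x)).
exists K0.+1 => //; rewrite -(lnK (_ : b \in Num.pos)) ?posrE ?(lt_trans _ b1) //.
rewrite -expRM_natl; set k : R := K0.+1%:R.
have k0 : 0 < k by rewrite ltr0n.
apply: le_trans (expR_ge1Dxn 1 _); last by rewrite mulr_ge0 ?ltW.
have : A <= x * k.
  rewrite mulrC -ler_pdivrMr //; apply: le_trans hK0 _; by rewrite ler_nat.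
have -> : (k * ln b) ^+ 2 / 2`!%:R = k * (x * k).
  by rewrite /x (_ : 2`! = 2)%N //; field.
by nra.
Qed.

(** Here [2 ^ p] plays the role of [1 / eps], [2 ^ (K * p)] is the sample size [m], and the left
    side is [h]. As [p < 2 ^ p], [h <= 10 * K * 4 ^ p <= (40 * K) ^ p], so one [K] with
    [40 * K <= 2 ^ (c * K)] serves every [p]. *)
Lemma sample_size (R : realType) (c : R) : 0 < c ->
  exists2 K : nat, (0 < K)%N & forall p : nat, (0 < p)%N ->
    (2 * (4 * (K * p) * 2 ^ p) + 2)%:R <= (2 ^ (K * p))%:R `^ c :> R.
Proof.
move=> c0; have b1 : 1 < 2 `^ c :> R.
  have := gt0_ltr_powR c0; move=> /(_ 1 2); rewrite powR1; apply; rewrite ?nnegrE //.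
  by rewrite ltr1n.
have [K K0 hK] := linear_le_exp 40 b1; exists K => // p p0.
have -> : (2 ^ (K * p))%:R `^ c = ((2 `^ c) ^+ K) ^+ p :> R.
  rewrite natrX -powR_mulrn // -powRrM mulrC powRrM powR_mulrn ?powR_ge0 //.
  by rewrite exprM.
apply: (@le_trans _ _ ((40 * K%:R) ^+ p)); last first.
  by apply: lerXn2r; rewrite ?nnegrE ?mulr_ge0 // exprn_ge0 // powR_ge0.
rewrite -[40]/(40%:R) -natrM -natrX ler_nat.
apply: (@leq_trans (10 * K * (4 ^ p))).
  have -> : (4 ^ p = 2 ^ p * 2 ^ p)%N by rewrite -expnMn.
  have := ltn_expl p (ltnSn 1); nia.
have -> : (40 * K = 10 * K * 4)%N by lia.
rewrite (expnMn (10 * K)) leq_mul2r; apply/orP; right.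
by rewrite -{1}[(10 * K)%N]expn1 leq_pexp2l // muln_gt0 K0.
Qed.

(** Take the least [p] with [2 ^ -p <= eps]. Minimality gives [eps < 2 ^ (1 - p)], and squaring
    suffices because [eps < 1 / 2] forces [p >= 2]. *)
Lemma dyadic_approx (R : realType) (eps : R) : 0 < eps -> eps < 1 / 2 ->
  exists2 p : nat, (0 < p)%N & (2 ^ p)%:R^-1 <= eps /\ eps ^+ 2 <= (2 ^ p)%:R^-1.
Proof.
move=> e0 e1; have ex : exists p : nat, (2 ^ p)%:R^-1 <= eps.
  exists (Num.trunc eps^-1).+1; rewrite -[leRHS]invrK lef_pV2 ?posrE ?invr_gt0 //;
    last by rewrite ltr0n expn_gt0.
  have eV0 : 0 <= eps^-1 by rewrite invr_ge0 ltW.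
  have /andP[_ /ltW h] := truncn_itv eV0; apply: le_trans h _.
  by rewrite ler_nat ltnW // ltn_expl.
have [[|[|p]] hp pmin] := ex_minnP ex.
- by move: hp; rewrite expn0 invr1; lra.
- by move: hp; rewrite expn1; lra.
exists p.+2 => //; split=> //.
have : eps < (2 ^ p.+1)%:R^-1.
  by rewrite ltNge; apply/negP => /pmin; rewrite ltnn.
rewrite !natrX => lt_eps.
apply: (@le_trans _ _ ((2 ^+ p.+1)^-1 ^+ 2)).
  by apply: lerXn2r; rewrite ?nnegrE ?ltW // invr_gt0 exprn_gt0.
rewrite -exprVn -exprM -exprVn ler_wiXn2l //; [lra|lra|lia].
Qed.

(** * The two implications *)

Section Equivalence.
Variables (R : realType) (F : graph_family).

Lemma erdos_hajnal_close_rodl : hereditary F ->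
  erdos_hajnal R F -> polynomial_close_rodl R F.
Proof.
move=> hF [c c0 EH]; have [K K0 hK] := sample_size c0.
(* With [mu = 2 ^ (K * p)], [eps ^ 2 <= 2 ^ -p] gives [eps ^ (2 * K) <= 1 / mu]. So [eps ^ (8 * K)]
   is below the size threshold [mu ^ -4] of the counting, and [eps ^ (4 * K)] below the edit density
   [mu ^ -2] that sampling tolerates. *)
exists (8 * K)%:R, (4 * K)%:R; split; rewrite ?ltr0n ?muln_gt0 //.
move=> eps e0 e1 V G [H FH close].
have [p p0 [hp1 hp2]] := dyadic_approx e0 e1.
rewrite !powR_mulrn ?(ltW e0) // in close *.
case: (boolP [exists S : {set V}, (eps ^+ (8 * K) * #|V|%:R <= #|S|%:R) &&
    ((edge_density R (induced G S) <= eps) || (1 - eps <= edge_density R (induced G S)))]).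
  case/existsP => S /andP[hS /orP homS]; by exists S.
rewrite negb_exists => /forallP noS; exfalso.
have {noS} nohom (S : {set V}) : eps ^+ (8 * K) * #|V|%:R <= #|S|%:R ->
    ~ homogeneous G eps S.
  by move=> hS /orP homS; have := noS S; rewrite hS homS.
have dense (L : graph V) (S : {set V}) : L = G \/ L = compl G ->
    eps ^+ (8 * K) * #|V|%:R <= #|S|%:R ->
    eps * (#|S| * #|S|.-1)%:R < (degsum L S)%:R.
  move=> hL /nohom hS; rewrite ltNge; apply/negP => le; apply: hS.
  by apply/homogeneousE; [exact: ltW|exists L].
have small_hom (S : {set V}) : (#|S| <= 1)%N -> homogeneous G eps S.
  move=> S1; apply/homogeneousE; first exact: ltW.
  exists G; first by left.
  rewrite /degsum big1 ?mulr_ge0 ?(ltW e0) // => x xS.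
  apply/eqP; rewrite cards_eq0 -subset0; apply/subsetP => y; rewrite inE => /andP[yS].
  by rewrite (card_le1P S1 x xS y) inE in yS; rewrite (eqP yS) adj_irrefl.
have V0 : (0 < #|V|)%N.
  rewrite lt0n; apply/eqP => V0; apply: (nohom set0); rewrite ?V0 ?cards0 ?mulr0 //.
  by apply: small_hom; rewrite cards0.
set q := (K * p)%N; pose mu : R := 2 ^+ q.
have muE : mu = (2 ^ p)%:R ^+ K by rewrite /mu /q mulnC exprM natrX.
have mu0 : 0 < mu by rewrite exprn_gt0.
have mu1 : 1 <= mu by rewrite exprn_ege1 // ler1n.
have epsX k : eps ^+ (2 * k * K) <= (mu ^+ k)^-1.
  rewrite -mulnA exprM muE -(exprM (2 ^ p)%:R) (mulnC K) -exprVn.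
  by apply: lerXn2r; rewrite ?nnegrE ?invr_ge0 ?sqr_ge0.
have e8 : eps ^+ (8 * K) <= (mu ^+ 4)^-1 := epsX 4.
have e4 : eps ^+ (4 * K) <= (mu ^+ 2)^-1 := epsX 2.
have q0 : (0 < q)%N by rewrite muln_gt0 K0.
have n0 : 0 < #|V|%:R :> R by rewrite ltr0n.
have sparse L : L = G \/ L = compl G ->
    #|[set I : {set V} | is_independent L I & #|I| == (2 * (4 * q * 2 ^ p) + 2)%N]|%:R
      * (mu / #|V|%:R) ^+ (2 * (4 * q * 2 ^ p) + 2) <= 16^-1 :> R.
  move=> hL; apply: few_independent_sets => //; first by rewrite expn_gt0.
  move=> S leS; apply: le_lt_trans (dense L S hL _); first by rewrite ler_wpM2r.
  by apply: le_trans leS; rewrite mulrC ler_wpM2l ?(ltW n0).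
(* If [#|V| < mu], then [eps ^ (8 * K) * #|V| <= 1], and a single vertex would be a large enough
   homogeneous set. *)
have mV : (2 ^ q <= #|V|)%N.
  rewrite leqNgt; apply/negP => ltV.
  have [x _] := card_gt0P V0.
  apply: (nohom [set x]); last by apply: small_hom; rewrite cards1.
  rewrite cards1; apply: le_trans (ler_wpM2r (ltW n0) e8) _.
  rewrite ler_pdivrMl ?exprn_gt0 // mulr1.
  apply: (@le_trans _ _ mu); first by rewrite /mu -natrX ler_nat ltnW.
  by rewrite -[leLHS]expr1 ler_weXn2l.
have muN : mu = (2 ^ q)%:R by rewrite natrX.
set h := (2 * (4 * q * 2 ^ p) + 2)%N in sparse.
set D := (edges G :\: edges H) :|: (edges H :\: edges G) in close.
pose hsets L := [set I : {set V} | is_independent L I & #|I| == h].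
have card_edge (L : graph V) e : e \in edges L -> #|e| = 2%N.
  rewrite inE => /existsP[a /existsP[b /andP[ab /eqP ->]]]; rewrite cards2.
  by have [E|//] := eqVneq a b; rewrite E adj_irrefl in ab.
have [||||||M cM Mgood] := @exists_sample R V D (hsets (compl G)) (hsets G) (2 ^ q) h V0 mV.
- by move=> e; rewrite in_setU !in_setD => /orP[] /andP[_ /card_edge].
- by move=> J; rewrite inE => /andP[_ /eqP].
- by move=> J; rewrite inE => /andP[_ /eqP].
(* At most [n ^ 2 / (2 * mu ^ 2)] pairs differ, each caught with probability at most
   [(mu / n) ^ 2]. *)
- rewrite -muN expr_div_n.
  have mu20 : 0 < mu ^+ 2 by rewrite exprn_gt0.
  have n20 : 0 < #|V|%:R ^+ 2 :> R by rewrite exprn_gt0.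
  have {}close : #|D|%:R <= (mu ^+ 2)^-1 * #|V|%:R ^+ 2 / 2 :> R.
    by apply: le_trans close _; do 2!(rewrite ler_wpM2r ?(ltW n20) ?invr_ge0 //).
  apply: le_trans (ler_wpM2r _ close) _; first by rewrite divr_ge0 ?exprn_ge0 ?(ltW mu0) ?(ltW n0).
  rewrite le_eqVlt; apply/orP; left; apply/eqP; field.
  by rewrite (gt_eqF n0) (gt_eqF mu0).
- by rewrite -muN; apply: sparse; right.
- by rewrite -muN; apply: sparse; left.
have FM : F _ (induced G M).
  apply: (in_family_iso (isomorphic_induced _) (hF _ _ M FH)).
  by move=> e /Mgood[].
(* The Erdős-Hajnal bound on [M] gives at least [m ^ c >= h], which contradicts the choice of
   [M]. *)
have hM : (h <= Defs.hom (induced G M))%N.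
  rewrite -(ler_nat R); apply: le_trans (EH _ _ FM).
  by rewrite card_sub -[#|_|]/(#|M|) cM hK.
have [J /andP[JM cJ]] := hom_induced hM.
have [_ [JC JI]] := Mgood J JM; move: JC JI; rewrite !inE cJ !andbT is_clique_compl.
by move=> /negbTE-> /negbTE->.
Qed.

Lemma close_rodl_erdos_hajnal : polynomial_close_rodl R F -> erdos_hajnal R F.
Proof.
(* For [eps = n ^ (-1 / a)] with [a = C + 1], the guaranteed size [eps ^ C * n] equals [1 / eps].
   The exponent [1 / (2 * a)] asks only for the square root [z] of [1 / eps], which absorbs the
   constant lost in Turán's bound once [z > 2]. *)
move=> [C [d [C0 d0 PR]]]; set a := C + 1; have a0 : 0 < a by rewrite /a; lra.
exists (2 * a)^-1 => [|V G FG]; first by rewrite invr_gt0 mulr_gt0.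
set n : R := #|V|%:R; set z := n `^ _.
have [V0|V0] := posnP #|V|.
  by rewrite /z /n V0 powR0 // gt_eqF // invr_gt0 mulr_gt0.
have n0 : 0 < n by rewrite ltr0n.
have [z2|z2] := lerP z 2.
  apply: (@le_trans _ _ (minn 2 #|V|)%:R); last by rewrite ler_nat leq_min2_hom.
  have [V1|V1] := leqP #|V| 1; last by rewrite (minn_idPl V1).
  have V1' : #|V| = 1%N by apply/eqP; rewrite eqn_leq V1.
  by rewrite /z /n V1' powR1.
have z0 : 0 < z by lra.
have zX : z ^+ 2 = n `^ a^-1.
  rewrite -powR_mulrn ?(ltW z0) // -powRrM; congr (_ `^ _).
  by rewrite /a; field; rewrite !gt_eqF //; lra.
have eps0 : 0 < (z ^+ 2)^-1 by rewrite invr_gt0 exprn_gt0.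
have eps1 : (z ^+ 2)^-1 < 1 / 2.
  by rewrite div1r ltf_pV2 ?posrE ?exprn_gt0 //; nra.
have [|S homS leS] := PR _ eps0 eps1 V G.
  (* A member of the family is at distance 0 from it. *)
  exists G => //; rewrite setDv setU0 cards0 !mulr_ge0 ?powR_ge0 ?invr_ge0 ?sqr_ge0 //.
have {}leS : z ^+ 2 <= #|S|%:R.
  apply: le_trans leS; rewrite zX -powRN -powRrM -/n.
  rewrite -[n in _ * n]powRr1 ?(ltW n0) // -powRD; last by rewrite (gt_eqF n0) implybT.
  rewrite le_eqVlt; apply/orP; left; apply/eqP; congr (_ `^ _).
  by rewrite /a; field; lra.
have [L hL degL] := (homogeneousE _ _ (ltW eps0)).1 homS.
set s : R := #|S|%:R in leS.
have z20 : 0 < z ^+ 2 by rewrite exprn_gt0.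
have s0 : 0 < s by apply: lt_le_trans leS.
have b0 : 0 < 1 + s / z ^+ 2 by rewrite addr_gt0 // divr_gt0.
have [|I /andP[_ iI] leI] := turan (G := L) (S := S) b0.
  apply: le_trans degL _; rewrite natrM addrC addKr -/s [s / _]mulrC -mulrA.
  by rewrite ler_wpM2l ?(ltW eps0) // ler_wpM2l ?(ltW s0) // ler_nat leq_pred.
have le_hom : (#|I| <= Defs.hom G)%N.
  by apply: leq_hom; rewrite is_clique_compl; case: hL iI => -> ->; rewrite ?orbT.
apply: (@le_trans _ _ #|I|%:R); last by rewrite ler_nat.
apply: le_trans leI; rewrite -/s ler_pdivlMr //.
have -> : z * (1 + s / z ^+ 2) = z + s / z by field; rewrite gt_eqF.
(* As [z > 2] and [z ^ 2 <= s], both [z] and [s / z] are at most [s / 2]. *)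
have : s / z <= s / 2 by rewrite ler_wpM2l ?(ltW s0) // lef_pV2 ?posrE // ltW.
by nra.
Qed.

End Equivalence.

Theorem theorem1p11 (R : realType) (F : graph_family) (hF : hereditary F) :
  erdos_hajnal R F <-> polynomial_close_rodl R F.
Proof.
split; [exact: erdos_hajnal_close_rodl|exact: close_rodl_erdos_hajnal].
Qed.
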